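(* For each integer $d\ge 1$, if $n\ge \operatorname{Ram}(4,6;2^d)$, then $\operatorname{bdim}(I_n)>d$.
   Context: For $n\ge 2$, the canonical interval order $I_n$ is the poset whose elements are the closed intervals $[i,j]$ with $i<j$ integers in $\{1,\dots,n\}$, ordered by $[i,j]<[k,l]$ iff $j<k$. $\operatorname{Ram}(k,h;r)$ denotes the least positive integer $N$ such that for every $n\ge N$ and every coloring of the $k$-element subsets of $\{1,\dots,n\}$ with $r$ colors there is an $h$-element subset all of whose $k$-element subsets receive the same color. Boolean dimension: for a poset $P$, let $\mathcal{B}=\{L_1,\dots,L_d\}$ be a non-empty family of linear orders on the ground set of $P$ (not necessarily linear extensions) and $\tau:\{0,1\}^d\to\{0,1\}$. For distinct $x,y$, $q(x,y,\mathcal{B})\in\{0,1\}^d$ has $i$-th coordinate $1$ iff $x<y$ in $L_i$. $(\mathcal{B},\tau)$ is a Boolean realizer if for all distinct $x,y$: $x<y$ in $P$ iff $\tau(q(x,y,\mathcal{B}))=1$. $\operatorname{bdim}(P)$ is the least $d$ for which $P$ has a Boolean realizer with $|\mathcal{B}|=d$. *)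

(* Defs.v *)
From HB Require Import structures.
From mathcomp Require Import all_boot all_order.
From mathcomp Require Import boolp.

Set Implicit Arguments.
Unset Strict Implicit.
Unset Printing Implicit Defensive.

Import Order.TTheory.

(* The ground set {1, ..., n} is represented by 'I_n = {0, ..., n - 1}. *)
Definition ksubset (n k : nat) := {A : {set 'I_n} | #|A| == k}.

Definition monochromatic (n k r : nat) (c : ksubset n k -> 'I_r)
    (H : {set 'I_n}) : Prop :=
  forall A B : ksubset n k, val A \subset H -> val B \subset H -> c A = c B.

Definition Ramsey_at (k h r n : nat) : Prop :=
  forall c : ksubset n k -> 'I_r,
    exists H : {set 'I_n}, #|H| = h /\ monochromatic c H.

Definition Ramsey_from (k h r N : nat) : Prop :=
  0 < N /\ forall n, N <= n -> Ramsey_at k h r n.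

Lemma subset_of_card (T : finType) (X : {set T}) m :
  m <= #|X| -> exists2 Y : {set T}, Y \subset X & #|Y| = m.
Proof.
move=> mX; exists [set x in take m (enum X)].
  apply/subsetP => x; rewrite inE => /mem_take.
  by rewrite mem_enum.
rewrite cardsE; have /card_uniqP -> := take_uniq m (enum_uniq (mem X)).
by rewrite size_take -cardE; case: ltngtP mX.
Qed.

Lemma Ramsey_off_diagonal (r k : nat) (h : 'I_r -> nat) :
  exists N, forall (T : finType) (X : {set T}) (c : {set T} -> 'I_r),
    N <= #|X| ->
    exists i (H : {set T}), [/\ H \subset X, #|H| = h i &
      forall A : {set T}, #|A| = k -> A \subset H -> c A = i].
Proof.
elim: k h => [|k IHk] h.
  exists (\sum_i h i) => T X c NX; exists (c set0).
  have [|H HX Hh] := @subset_of_card T X (h (c set0)).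
    by apply: leq_trans NX; rewrite (bigD1 (c set0)) //= leq_addr.
  by exists H; split=> // A /cards0_eq ->.
have [m] := ubnP (\sum_i h i); elim: m h => // m IHm h; rewrite ltnS => hm.
have [/existsP [i /eqP hi0]|/existsPn hpos] := boolP [exists i, h i == 0].
  exists 0 => T X c _; exists i, set0; split; rewrite ?sub0set ?cards0 //.
  by move=> A Ak; rewrite subset0 => /eqP A0; rewrite A0 cards0 in Ak.
pose h' (i j : 'I_r) := if j == i then (h j).-1 else h j.
have h'm i : \sum_j h' i j < m.
  apply: leq_trans hm; rewrite (bigD1 i) //= [leqRHS](bigD1 i) //= {1}/h' eqxx.
  rewrite -addSn prednK ?lt0n // leq_add2l leq_sum // => j.
  by rewrite /h' => /negPf ->.
have /fin_all_exists [N NP] := fun i => IHm (h' i) (h'm i).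
have {IHk} [M MP] := IHk N.
exists M.+1 => T X c MX.
have /card_gt0P [x xX] : 0 < #|X| by apply: leq_trans MX.
have [|i [Y [YX Yi cY]]] := MP T (X :\ x) (fun A => c (x |: A)).
  by move: MX; rewrite (cardsD1 x) xX.
have [|j [H [HY]]] := NP i T Y c; first by rewrite Yi.
have xH : x \notin H.
  by apply/negP => /(subsetP HY) /(subsetP YX); rewrite !inE eqxx.
have HX : H \subset X.
  exact: subset_trans HY (subset_trans YX (subsetDl _ _)).
rewrite /h'; case: eqVneq => [-> | _] Hj cH; last by exists j, H.
exists i, (x |: H); split.
- by rewrite subUset sub1set xX.
- by rewrite cardsU1 xH Hj add1n prednK // lt0n.
- move=> A Ak AH; have [xA | xA] := boolP (x \in A).
    rewrite -(setD1K xA); apply: cY.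
      by move: Ak; rewrite (cardsD1 x) xA => -[].
    by apply: subset_trans HY; rewrite subDset.
  apply: cH => //; apply/subsetP => y yA.
  have := subsetP AH y yA; rewrite !inE => /orP [/eqP yx | //].
  by rewrite -yx yA in xA.
Qed.

Lemma Ramsey_exists (k h r : nat) :
  exists N, `[< Ramsey_from k h r N >].
Proof.
have [N NP] := @Ramsey_off_diagonal r k (fun=> h).
exists (N + k).+1; apply/asboolP; split=> // n Nn c.
have [|A0 _ A0k] := @subset_of_card 'I_n setT k.
  by rewrite cardsT card_ord; apply: leq_trans Nn; rewrite leqW ?leq_addl.
have {A0k} A0 : ksubset n k by exists A0; apply/eqP.
have [|i [H [_ Hh cH]]] := NP 'I_n setT (fun A => c (insubd A0 A)).
  by rewrite cardsT card_ord; apply: leq_trans Nn; rewrite leqW ?leq_addr.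
exists H; split=> // A B AH BH.
have E (C : ksubset n k) : val C \subset H -> c C = i.
  move=> CH; rewrite -(cH (val C)) ?valKd //; exact/eqP/(valP C).
by rewrite !E.
Qed.

Definition Ram (k h r : nat) : nat := ex_minn (Ramsey_exists k h r).

Definition strict_linear_order (T : eqType) (L : rel T) : Prop :=
  [/\ irreflexive L, transitive L & forall x y, x != y -> L x y || L y x].

Definition query (T : Type) (d : nat) (L : 'I_d -> rel T) (x y : T) :
    d.-tuple bool :=
  [tuple L i x y | i < d].

Definition Boolean_realizer (disp : Order.disp_t) (P : finPOrderType disp)
    (d : nat) (L : 'I_d -> rel P) (tau : d.-tuple bool -> bool) : Prop :=
  (forall i, strict_linear_order (L i)) /\
  forall x y : P, x != y -> (x < y)%O <-> tau (query L x y) = true.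

(* The family may list an order twice; this does not affect the least d. *)
Definition has_Boolean_realizer (disp : Order.disp_t) (P : finPOrderType disp)
    (d : nat) : Prop :=
  0 < d /\ exists (L : 'I_d -> rel P) (tau : d.-tuple bool -> bool),
    Boolean_realizer L tau.

(* Listing each point first in one order and last in another makes the query
   of a pair of distinct points determine that pair. *)
Lemma has_Boolean_realizer_exists (disp : Order.disp_t)
    (P : finPOrderType disp) :
  exists d, `[< has_Boolean_realizer P d >].
Proof.
pose I : finType := option (P * bool).
pose key (i : I) (z : P) : nat :=
  match i with
  | None => enum_rank z
  | Some (a, true) => if z == a then 0 else (enum_rank z).+1
  | Some (a, false) => if z == a then #|P| else enum_rank z
  end.
have key_inj i : injective (key i).
  have rk_inj (u v : P) : enum_rank u = enum_rank v :> nat -> u = v.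
    by move=> /val_inj /enum_rank_inj.
  case: i => [[a []]|] u v /=; last exact: rk_inj.
    by do 2![case: eqVneq => [->|_]] => // -[] /rk_inj.
  case: eqVneq => [->|_]; case: eqVneq => [->|_] // E; last exact: rk_inj.
    by have := ltn_ord (enum_rank v); rewrite -E ltnn.
  by have := ltn_ord (enum_rank u); rewrite E ltnn.
pose L (i : 'I_#|I|) : rel P :=
  fun x y => key (enum_val i) x < key (enum_val i) y.
exists #|I|; apply/asboolP; split; first by apply/card_gt0P; exists None.
exists L, (fun t => [exists x : P, exists y : P,
  [&& x != y, (x < y)%O & t == query L x y]]); split=> [i|x y xy].
  split=> [x|y x z|x y xy]; rewrite /L ?ltnn //; first exact: ltn_trans.
  by rewrite -neq_ltn; apply: contraNneq xy => /key_inj ->.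
split=> [ltxy|/existsP [u /existsP [v /and3P [uv ltuv /eqP E]]]].
  by apply/existsP; exists x; apply/existsP; exists y; rewrite xy ltxy eqxx.
have {E} K j : (key j x < key j y) = (key j u < key j v).
  have := congr1 (fun t => tnth t (enum_rank j)) E.
  by rewrite !tnth_mktuple /L enum_rankK.
have rkP (z : P) : enum_rank z < #|P| by apply: ltn_ord.
have rkN (z : P) : (#|P| < enum_rank z) = false.
  by apply/negbTE; rewrite -leqNgt ltnW.
have Exu : u = x.
  move: (K (Some (x, true))) (K (Some (x, false))) => /=.
  rewrite !eqxx (eq_sym y x) (negPf xy) rkN /=.
  case: (eqVneq u x) => [//|_]; case: (eqVneq v x) => [//|_].
  by move=> E1 E2; move: E1; rewrite [RHS]ltnS -E2.
have Eyv : v = y.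
  move: (K (Some (y, true))) (K (Some (y, false))) => /=.
  rewrite !eqxx (negPf xy) rkP /= Exu (negPf xy).
  case: (eqVneq v y) => [//|_].
  by move=> E1 E2; move: E1; rewrite [RHS]ltnS -E2.
by rewrite -Exu -Eyv.
Qed.

Definition bdim (disp : Order.disp_t) (P : finPOrderType disp) : nat :=
  ex_minn (has_Boolean_realizer_exists P).

(* The pair (i, j) with i < j stands for the closed interval [i, j]; as above,
   the endpoints range over 'I_n instead of {1, ..., n}. *)
Definition canonical_interval_order (n : nat) :=
  {p : 'I_n * 'I_n | p.1 < p.2}.

HB.instance Definition _ (n : nat) :=
  Finite.on (canonical_interval_order n).
HB.instance Definition _ (n : nat) := SubType.on (canonical_interval_order n).

Definition interval_lt (n : nat) : rel (canonical_interval_order n) :=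
  fun I J => (val I).2 < (val J).1.

Fact interval_lt_irr n : irreflexive (@interval_lt n).
Proof. by move=> I; apply/negbTE; rewrite -leqNgt ltnW ?(valP I). Qed.

Fact interval_lt_trans n : transitive (@interval_lt n).
Proof.
move=> J I K IJ JK; exact: ltn_trans IJ (ltn_trans (valP J) JK).
Qed.

Fact interval_display : Order.disp_t. Proof. exact: Order.Disp tt tt. Qed.

HB.instance Definition _ (n : nat) :=
  Order.Lt_isPOrder.Build interval_display (canonical_interval_order n)
    (@interval_lt_irr n) (@interval_lt_trans n).

(* Main.v *)
Require Import Defs.
From mathcomp Require Import all_boot all_order.
From mathcomp Require Import boolp.

(** Colour a 4-subset a < b < c < e by the query of the incomparable pair
    [a,c], [b,e].  On a homogeneous set 1 < ... < 6 the pairs ([1,3], [2,5]) and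
    ([2,5], [4,6]) have the same query, hence by transitivity of each linear
    order so does ([1,3], [4,6]).  But [1,3] < [4,6] in the interval order,
    while [1,3] and [2,5] are incomparable. *)

Lemma Ram_Ramsey_at (k h r n : nat) : Ram k h r <= n -> Ramsey_at k h r n.
Proof. by rewrite /Ram; case: ex_minnP => N /asboolP [_ RN] _; apply: RN. Qed.

Lemma sorted_enum_ord_set (n : nat) (A : {set 'I_n}) :
  sorted (fun i j : 'I_n => i < j) (enum A).
Proof.
rewrite {1}/enum_mem -enumT; apply: sorted_filter => [j i k|].
  exact: ltn_trans.
by rewrite -(sorted_map (f := val) (e' := ltn)) val_enum_ord iota_ltn_sorted.
Qed.

(** Two strictly increasing lists with the same members coincide. *)
Lemma enum_set_sorted_ord (n : nat) (s : seq 'I_n) :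
  sorted (fun i j : 'I_n => i < j) s -> enum [set x in s] = s.
Proof.
move=> ss; apply: irr_sorted_eq (sorted_enum_ord_set _ _) ss _ => [j i k|i|x].
- exact: ltn_trans.
- exact: ltnn.
- by rewrite mem_enum inE.
Qed.

(** Increasing lists let a colouring name the points of a subset in order by pattern matching, and a
    general colour type [C] lets queries themselves serve as colours. *)
Lemma Ramsey_at_seq (k h r n : nat) (C : finType) (c : seq 'I_n -> C) :
  #|C| <= r -> Ramsey_at k h r n ->
  exists s : seq 'I_n,
    [/\ sorted (fun i j : 'I_n => i < j) s, size s = h &
      forall t u, subseq t s -> subseq u s -> size t = k -> size u = k ->
        c t = c u].
Proof.
(* [enum_rank] followed by [widen_ord] is injective, so equal ordinal colours give back equal values
   of [c]. *)
move=> Cr /(_ (fun A => widen_ord Cr (enum_rank (c (enum (val A)))))).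
case=> H [Hh cH]; exists (enum H).
split=> [||t u tH uH tk uk]; [exact: sorted_enum_ord_set | by rewrite -cardE |].
have P v : subseq v (enum H) -> size v = k ->
    [/\ enum [set x in v] = v, #|[set x in v]| == k & [set x in v] \subset H].
  move=> vH vk; have vE : enum [set x in v] = v.
    apply/enum_set_sorted_ord/(subseq_sorted _ vH (sorted_enum_ord_set _ H)).
    by move=> j i l; apply: ltn_trans.
  split; rewrite // ?cardE ?vE ?vk //.
  by apply/subsetP => x; rewrite inE => /(mem_subseq vH); rewrite mem_enum.
have [tE tc tS] := P t tH tk; have [uE uc uS] := P u uH uk.
pose T : ksubset n k := exist _ [set x in t] tc.
pose U : ksubset n k := exist _ [set x in u] uc.
have /(congr1 val) /= /val_inj /enum_rank_inj := cH T U tS uS.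
by rewrite tE uE.
Qed.

(** Coordinatewise: a common bit 1 means x < y < z in [L i]; a common bit 0 means z < y < x by
    totality, which excludes x < z. *)
Lemma query_trans (T : eqType) (d : nat) (L : 'I_d -> rel T) (x y z : T) :
  (forall i, strict_linear_order (L i)) -> x != y -> y != z ->
  query L x y = query L y z -> query L x z = query L x y.
Proof.
move=> lin xy yz E; apply: eq_from_tnth => i.
move: (congr1 (fun t => tnth t i) E); rewrite !tnth_mktuple.
have [irr tr tot] := lin i; case Lxy: (L i x y) => Lyz; first exact: tr Lxy _.
have Lyx : L i y x by have := tot _ _ xy; rewrite Lxy.
have Lzy : L i z y by have := tot _ _ yz; rewrite -Lyz.
by apply/negP => /(tr _ _ _ (tr _ _ _ Lzy Lyx)); rewrite irr.
Qed.

Theorem theorem2p2 (d n : nat) (hd : 1 <= d) (hn : Ram 4 6 (2 ^ d) <= n) :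
  bdim (canonical_interval_order n) > d.
Proof.
rewrite /bdim; case: ex_minnP => m /asboolP [_ [L [tau [lin real]]]] _.
rewrite ltnNge; apply/negP => md.
pose I i j : option (canonical_interval_order n) := insub (i, j).
pose c (s : seq 'I_n) : option (m.-tuple bool) :=
  if s is [:: a; b; c; e] then
    obind (fun x => omap (query L x) (I b e)) (I a c)
  else None.
(* The all-false tuple is a dummy where [c] is undefined, which never happens on increasing lists of
   length 4. *)
pose c' s := odflt [tuple of nseq m false] (c s).
(* The assumption m <= d enters here: queries of length m give at most 2^d colours. *)
have Cd : #|{: m.-tuple bool}| <= 2 ^ d by rewrite card_tuple card_bool leq_exp2l.
have [s [ss s6 cs]] := Ramsey_at_seq _ _ _ _ _ c' Cd (Ram_Ramsey_at _ _ _ _ hn).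
case: s ss s6 cs => [|a1 [|a2 [|a3 [|a4 [|a5 [|a6 []]]]]]] //.
case/and5P=> h12 h23 h34 h45 /andP [h56 _] _ cs.
have h13 := ltn_trans h12 h23; have h46 := ltn_trans h45 h56.
have h25 := ltn_trans h23 (ltn_trans h34 h45).
pose x : canonical_interval_order n := Sub (a1, a3) h13.
pose y : canonical_interval_order n := Sub (a2, a5) h25.
pose z : canonical_interval_order n := Sub (a4, a6) h46.
have E : query L x y = query L y z.
  (* The masks select positions 1, 2, 3, 5 and 2, 4, 5, 6, whose colours are the queries of (x, y)
     and (y, z). *)
  have := cs [:: a1; a2; a3; a5] [:: a2; a4; a5; a6]
    (mask_subseq [:: true; true; true; false; true; false] [:: _; _; _; _; _; _])
    (mask_subseq [:: false; true; false; true; true; true] [:: _; _; _; _; _; _])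
    erefl erefl.
  have IE (i j : 'I_n) (ij : i < j) : I i j = Some (Sub (i, j) ij).
    exact: (insubT (fun p : 'I_n * 'I_n => p.1 < p.2)).
  by rewrite /c' /c (IE _ _ h13) (IE _ _ h25) (IE _ _ h46).
have neq (u v : canonical_interval_order n) : (val u).1 < (val v).1 -> u != v.
  by move=> uv; apply: contraTneq uv => ->; rewrite ltnn.
have xy : x != y by apply: neq.
have yz : y != z by apply: neq; apply: ltn_trans h34.
have xz : x != z by apply: neq; apply: ltn_trans h34.
have ltxz : (x < z)%O by apply: h34.
(* [tau] accepts the query of (x, z) since x < z. The query of (x, y) is the same, so x < y would
   follow, that is, [a3 < a2]. *)
have /(real _ _ xy) : tau (query L x y) = true.
  by rewrite -(query_trans _ _ _ _ _ _ lin xy yz E); apply/(real _ _ xz).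
by change (a3 < a2 -> False); rewrite ltnNge (ltnW h23).
Qed.
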